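(* Assume that: (1) $\mathscr{H}$ is separable; (2) the canonical feature map $\varphi : E\to\mathscr{H}$ is Borel measurable; (3) $\mathbb{E}[\|\varphi(X)\|_{\mathscr{H}}^2]<\infty$ and $\mathbb{E}[\|\varphi(Y)\|_{\mathscr{H}}^2]<\infty$; (4) $\mathscr{H}\subseteq C_0(E)$; (5) $\mathscr{H}$ is dense in $L^2(\pi)$. Then for every $\delta>0$ there exists a Hilbert--Schmidt operator $A:\mathscr{H}\to\mathscr{H}$ such that $$\|A-P\|_{\mathscr{H}\to L^2(\pi)}<\delta .$$
   Context: Let $E$ be a second countable locally compact Hausdorff space with Borel $\sigma$-field $\mathcal{F}_E$, and let $X,Y$ be $E$-valued random variables on a common probability space $(\Omega,\mathcal{F},\mathbb{P})$ with laws $X\sim\pi$ and $Y\sim\nu$. Let $p:E\times\mathcal{F}_E\to[0,1]$ be a Markov kernel that is a regular version of the conditional distribution of $Y$ given $X$, i.e. $\mathbb{P}[X\in\mathcal{A},Y\in\mathcal{B}]=\int_{\mathcal{A}}p(x,\mathcal{B})\,d\pi(x)$ for all $\mathcal{A},\mathcal{B}\in\mathcal{F}_E$. Write $L^2(\pi)=L^2(E,\mathcal{F}_E,\pi;\mathbb{R})$. The conditional expectation operator is $P:L^2(\nu)\to L^2(\pi)$, $[Pf](x)=\mathbb{E}[f(Y)\mid X=x]=\int_E f(y)\,p(x,dy)$. $\mathscr{H}$ is the real reproducing kernel Hilbert space of functions $E\to\mathbb{R}$ with kernel $k:E\times E\to\mathbb{R}$ and canonical feature map $\varphi(x)=k(x,\cdot)$.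 $C_0(E)$ is the space of continuous real-valued functions on $E$ vanishing at infinity. Under (1)--(3), the inclusions $i_\pi:\mathscr{H}\to L^2(\pi)$ and $i_\nu:\mathscr{H}\to L^2(\nu)$, sending $f$ to its a.e.-equivalence class, are bounded; ''dense in $L^2(\pi)$'' means that the range of $i_\pi$ is dense. For bounded $A:\mathscr{H}\to\mathscr{H}$, the quantity $\|A-P\|_{\mathscr{H}\to L^2(\pi)}$ denotes the operator norm of $i_\pi A-P\,i_\nu:\mathscr{H}\to L^2(\pi)$. *)

(* Defs.v *)
From HB Require Import structures.
From mathcomp Require Import all_boot all_order all_algebra.
From mathcomp Require Import all_classical all_reals all_analysis.
From mathcomp Require Import measurable_realfun.

Set Implicit Arguments.
Unset Strict Implicit.
Unset Printing Implicit Defensive.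

Import Order.TTheory GRing.Theory Num.Theory.
Import numFieldNormedType.Exports.

Local Open Scope classical_set_scope.
Local Open Scope ring_scope.

Definition borel (T : ptopologicalType) := g_sigma_algebraType (@open T).

HB.mixin Record CompleteNormedModule_isHilbert (R : realType) H
    & CompleteNormedModule R H := {
  dotp : {dot H for @idfun R} ;
  dotp_norm : forall u : H, dotp u u = `|u| ^+ 2
}.

#[short(type="hilbertType")]
HB.structure Definition Hilbert (R : realType) :=
  {H of CompleteNormedModule R H & CompleteNormedModule_isHilbert R H}.

Section hilbert.
Context {R : realType}.

Definition separable (T : topologicalType) :=
  exists2 D : set T, countable D & dense D.

Definition linear_span (V : lmodType R) (B : set V) : set V :=
  [set x | exists (s : seq V) (c : V -> R),
     (forall e, e \in s -> B e) /\ x = \sum_(e <- s) c e *: e].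

Definition orthonormal_basis (H : hilbertType R) (B : set H) :=
  [/\ forall e, B e -> dotp e e = 1,
      forall e f, B e -> B f -> e != f -> dotp e f = 0
    & dense (linear_span B)].

(* Finiteness of the sum does not depend on the choice of the basis, but it does
   not imply boundedness, which is therefore a separate clause. *)
Definition hilbert_schmidt (H K : hilbertType R) (A : {linear H -> K}) :=
  continuous A /\
  exists2 B : set H, orthonormal_basis B &
    (\esum_(e in B) (`|A e| ^+ 2)%:E < +oo)%E.

End hilbert.

(* The elements of the space are abstract; rkhs_fun sends them injectively and
   linearly to functions, and rkhs_feature x is the element whose function is
   k(x, .). *)
Record rkhs (R : realType) (E : Type) (k : E -> E -> R) := Rkhs {
  rkhs_space :> hilbertType R ;
  rkhs_fun : {linear rkhs_space -> (E -> R)} ;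
  rkhs_feature : E -> rkhs_space ;
  rkhs_fun_inj : injective rkhs_fun ;
  rkhs_featureE : forall x, rkhs_fun (rkhs_feature x) = k x ;
  rkhs_reproducing : forall f x, rkhs_fun f x = dotp f (rkhs_feature x)
}.

Definition C0 (R : realType) (E : topologicalType) (f : E -> R) :=
  continuous f /\
  forall e : R, 0 < e -> exists2 C : set E, compact C &
    forall x, ~ C x -> `|f x| < e.

Section L2.
Context d {T : measurableType d} {R : realType}.

(* Elements of L^2 are represented by functions, the L^2 distance being the
   seminorm 'N[mu]_2. *)
Definition dense_in_L2 (mu : {measure set T -> \bar R}) (S : set (T -> R)) :=
  forall g, g \in Lfun mu 2%:E -> forall e : R, 0 < e ->
    exists2 f, S f & ('N[mu]_2%:E[EFin \o (f \- g)%R] < e%:E)%E.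

Definition L2_opnorm (V : normedModType R) (mu : {measure set T -> \bar R})
    (A : V -> T -> R) : \bar R :=
  ereal_sup [set 'N[mu]_2%:E[EFin \o A v]%E | v in [set v : V | `|v| <= 1]].

End L2.

Section conditional_expectation.
Context d d1 d2 {W : measurableType d} {T1 : measurableType d1}
  {T2 : measurableType d2} {R : realType}.

Definition regular_cond_distribution (Pr : probability W R)
    (X : {RV Pr >-> T1}) (Y : {RV Pr >-> T2}) (p : R.-pker T1 ~> T2) :=
  forall A B, measurable A -> measurable B ->
    Pr (X @^-1` A `&` Y @^-1` B) = (\int[distribution Pr X]_(x in A) p x B)%E.

Definition condexp (p : R.-pker T1 ~> T2) (f : T2 -> R) : T1 -> R :=
  fun x => (\int[p x]_y f y)%R.

End conditional_expectation.

(* condexp_ae_eq and condexp_Lfun below show that condexp p, which acts on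
   functions, induces a map L^2(law of Y) -> L^2(law of X) on a.e. classes. *)
Section condexp_L2.
Context d d1 d2 {W : measurableType d} {T1 : measurableType d1}
  {T2 : measurableType d2} {R : realType}.
Context (Pr : probability W R) (X : {RV Pr >-> T1}) (Y : {RV Pr >-> T2}).
Context (p : R.-pker T1 ~> T2) (pXY : regular_cond_distribution X Y p).
Local Open Scope ereal_scope.

Lemma regular_cond_distribution_integral (f : T2 -> \bar R) :
  (forall y, 0 <= f y) -> measurable_fun [set: T2] f ->
  \int[distribution Pr Y]_y f y =
  \int[distribution Pr X]_x \int[p x]_y f y.
Proof.
move=> f0 mf.
pose mP : measurable_fun [set: unit] (fun=> distribution Pr X : pprobability T1 R) :=
  measurable_cst _.
have := @integral_kcomp _ _ _ _ _ _ _ (kprobability mP) (kernel.kernel_snd (T0 := unit) p) tt f f0 mf.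
move=> /= <-.
apply: eq_measure_integral => A mA _.
rewrite /kcomp /= /kprobability/= -[LHS](_ : Pr (X @^-1` setT `&` Y @^-1` A) = _); last first.
  by rewrite preimage_setT setTI.
exact: pXY.
Qed.

Lemma condexp_ae_eq (f g : T2 -> R) :
  measurable_fun [set: T2] f -> measurable_fun [set: T2] g ->
  f = g %[ae distribution Pr Y] ->
  condexp p f = condexp p g %[ae distribution Pr X].
Proof.
move=> mf mg [N [mN N0 fgN]].
have h : \int[distribution Pr X]_x p x N = 0.
  by rewrite -pXY// preimage_setT setTI.
have mpN : measurable_fun [set: T1] (p ^~ N) by exact: measurable_kernel.
have : ae_eq (distribution Pr X) setT (p ^~ N) (cst 0).
  apply/(ae_eq_integral_abs _ measurableT mpN).1; rewrite -[RHS]h.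
  by apply: eq_integral => x _; rewrite gee0_abs.
apply: filterS => x /(_ I)/= pxN _.
rewrite /condexp /Rintegral; congr fine.
apply: ae_eq_integral => //; [exact/measurable_EFinP..|].
exists N; split => // y /= /not_implyP[_ fg]; apply: fgN => /= /(_ I) fgy.
by apply: fg; rewrite fgy.
Qed.

Lemma measurable_condexp (f : T2 -> R) :
  measurable_fun [set: T2] f -> measurable_fun [set: T1] (condexp p f).
Proof.
move=> mf; have mEf : measurable_fun [set: T2] (EFin \o f).
  exact/measurable_EFinP.
have mp : forall U, measurable U -> measurable_fun [set: T1] (p ^~ U).
  by move=> U mU; exact: measurable_kernel.
apply: (measurableT_comp (fine_measurable measurableT)) => //.
under eq_fun do rewrite integralE.
apply: emeasurable_funB; apply: measurable_fun_integral_kernel => //.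
- exact: measurable_funepos.
- exact: measurable_funeneg.
Qed.

Lemma condexp_Lfun (f : T2 -> R) :
  f \in Lfun (distribution Pr Y) 2%:E ->
  condexp p f \in Lfun (distribution Pr X) 2%:E.
Proof.
rewrite !inE => /andP[]; rewrite !inE/= => mf.
rewrite /finite_norm => f2.
have mcf := measurable_condexp mf.
apply/andP; rewrite !inE/=; split => //.
have msq d' (T : measurableType d') (g : T -> R) : measurable_fun [set: T] g ->
    measurable_fun [set: T] (fun x => `|(g x)%:E| `^ 2).
  move=> mg; apply: (measurableT_comp (measurable_poweR _)) => //.
  by apply/measurableT_comp => //; exact/measurable_EFinP.
have cf x : `|(condexp p f x)%:E| <= 'N[p x]_2%:E[EFin \o f].
  apply: (@le_trans _ _ 'N[p x]_1[EFin \o f]).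
    rewrite Lnorm1; apply: le_trans (le_abse_integral (p x) measurableT _) => /=.
      rewrite /condexp /Rintegral/=.
      by case: (\int[p x]_y (f y)%:E) => [r||] /=; rewrite ?normr0 ?leey.
    exact/measurable_EFinP.
  have := @hoelder _ _ _ (p x) f (cst 1%R) 2 2 mf (measurable_cst _).
  rewrite Lnorm_cst1 prob_kernel poweR1r mule1.
  rewrite (_ : (f \* cst 1)%R = f); last by apply/funext => y /=; rewrite mulr1.
  by apply => //; rewrite [RHS]splitr !div1r.
rewrite /finite_norm unlock poweR_lty//.
apply: (@le_lt_trans _ _ (\int[distribution Pr X]_x \int[p x]_y `|(f y)%:E| `^ 2)).
  apply: ge0_le_integral => //.
  - by move=> x _; exact: poweR_ge0.
  - exact: msq.
  - apply: measurable_fun_integral_kernel => [U mU|y|].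
    + exact: measurable_kernel.
    + exact: poweR_ge0.
    + exact: msq.
  - move=> x _ /=.
    have -> : \int[p x]_y `|(f y)%:E| `^ 2 = 'N[p x]_2%:E[EFin \o f] `^ 2.
      by rewrite poweR_Lnorm ?pnatr_eq0.
    apply: (gt0_ler_poweR _ _ _ (cf x)); first by [].
    + by rewrite in_itv/= leey lee_fin normr_ge0.
    + by rewrite in_itv/= leey Lnorm_ge0.
rewrite -regular_cond_distribution_integral; last 2 first.
- by move=> y; exact: poweR_ge0.
- exact: msq.
by move: f2; rewrite unlock; apply: lty_poweRy; rewrite invr_eq0 pnatr_eq0.
Qed.

End condexp_L2.

(* Main.v *)
From HB Require Import structures.
Require Import Defs.
From mathcomp Require Import all_boot all_order all_algebra.
From mathcomp Require Import all_classical all_reals all_analysis.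
From mathcomp Require Import ring lra measurable_realfun.

Import Order.TTheory GRing.Theory Num.Theory.
Import numFieldNormedType.Exports.
Local Open Scope classical_set_scope.
Local Open Scope ring_scope.

(** The restriction of P to the RKHS is well approximated by its values on
finitely many orthonormal vectors, because the embedding of the RKHS into
L^2(nu) is Hilbert-Schmidt; those finitely many values are then replaced by
nearby elements of the RKHS, which is dense in L^2(pi). So A can be taken of
finite rank.

Let e_0, e_1, ... come from a dense sequence of H by Gram-Schmidt, and let r_n
be the projection onto the orthogonal complement of e_0, ..., e_(n-1)
([residual]). The projection r_n is self-adjoint, so the reproducing property
gives (r_n v)(y) = <v, r_n phi(y)>, hence |(r_n v)(y)| <= |v| |r_n phi(y)|.
Pointwise r_n phi(y) tends to 0 ([residual_cvg0]) and is dominated by |phi(y)|,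
which is square integrable for nu, so y |-> |r_n phi(y)| tends to 0 in L^2(nu)
([residual_Lnorm2_le]). As P is a contraction from L^2(nu) to L^2(pi)
([condexp_contraction]), P r_n is small in operator norm for some n.

For that n, choose h_i in H close to P e_i in L^2(pi) for each i, and set
A v = sum_(i < n) <v, e_i> h_i. Then
  A v - P v = sum_(i < n) <v, e_i> (h_i - P e_i) - P (r_n v),
where both parts are small in L^2(pi), uniformly over the unit ball. This
identity is between functions rather than a.e. classes: elements of H are
bounded, being in C_0, so that the integral against every p(x, .) is linear on
them ([condexp_rkhs_linear]). Finally A is Hilbert-Schmidt because the e_i that
do not vanish form an orthonormal basis, and A kills all but finitely many of
them ([finite_rank_hilbert_schmidt]). *)

(** * Gram-Schmidt orthonormalization *)

Section hilbert_geometry.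
Context {R : realType} {H : hilbertType R}.
Implicit Types (u v w x y : H) (d : nat -> H).

Lemma dotC u v : dotp u v = dotp v u.
Proof. by rewrite (hermitian_subproof (s := dotp)) expr0 mul1r. Qed.

Lemma dotZl (a : R) u v : dotp (a *: u) v = a * dotp u v.
Proof. by rewrite linearZl_LR. Qed.

Lemma dot_suml n (f : 'I_n -> H) v :
  dotp (\sum_(i < n) f i) v = \sum_(i < n) dotp (f i) v.
Proof. exact: linear_sumlz. Qed.

Lemma dot0l u : dotp 0 u = 0.
Proof. by rewrite linear0l. Qed.

Lemma dot0r u : dotp u 0 = 0.
Proof. by rewrite dotC dot0l. Qed.

(** Positivity of <w, w> for w = <v, v> u - <u, v> v, which spans the part of u
orthogonal to v and requires no division. *)
Lemma dot_sqr_le u v : dotp u v ^+ 2 <= `|u| ^+ 2 * `|v| ^+ 2.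
Proof.
rewrite -!dotp_norm.
have [->|v0] := eqVneq v 0; first by rewrite !dot0r expr0n /= mulr0.
have vv0 : 0 < dotp v v by rewrite neq0_dnorm_gt0.
pose w := dotp v v *: u - dotp u v *: v.
have : 0 <= dotp w w by rewrite dotp_norm exprn_ge0.
rewrite /w linearBl /= !linearBr /= !dotZl !(dotC _ (_ *: _)) !dotZl (dotC v u).
set a := dotp v v; set b := dotp u v; set c := dotp u u.
have -> : a * (a * c) - a * (b * b) - (b * (a * b) - b * (b * a))
     = a * (c * a - b ^+ 2) by ring.
by rewrite pmulr_rge0 // subr_ge0.
Qed.

Lemma cauchy_schwarz u v : `|dotp u v| <= `|u| * `|v|.
Proof.
rewrite -(@ler_pXn2r _ 2) ?nnegrE ?mulr_ge0 //.
by rewrite exprMn real_normK ?num_real // dot_sqr_le.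
Qed.

(** The zero vector is sent to itself. The body is locked because rewrite rules on
scaled vectors would otherwise unfold it. *)
Definition normalize := locked (fun u => `|u|^-1 *: u).

Lemma normalizeE u : normalize u = `|u|^-1 *: u.
Proof. by rewrite /normalize -lock. Qed.

Lemma dot_normalize u : normalize u != 0 -> dotp (normalize u) (normalize u) = 1.
Proof.
rewrite normalizeE; have [->|u0 _] := eqVneq u 0; first by rewrite scaler0 eqxx.
by rewrite dotp_norm normrZ normfV normr_id mulVf ?expr1n // normr_eq0.
Qed.

(** The map x |-> x minus its projection onto the span of d 0, ..., d (n - 1).
Recursing on the complementary projection, rather than on the list of
orthonormalized vectors, makes each new vector the normalized residual of the
next d n; it is zero when d n depends on its predecessors. *)
Fixpoint residual d n : H -> H :=
  if n is m.+1 then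
    let e := normalize (residual d m (d m)) in
    fun x => residual d m x - dotp (residual d m x) e *: e
  else id.

Definition gram_schmidt d n := normalize (residual d n (d n)).

Lemma residualS d n x : residual d n.+1 x =
  residual d n x - dotp (residual d n x) (gram_schmidt d n) *: gram_schmidt d n.
Proof. by []. Qed.

Lemma dot_gram_schmidt d n : gram_schmidt d n != 0 ->
  dotp (gram_schmidt d n) (gram_schmidt d n) = 1.
Proof. exact: dot_normalize. Qed.

Lemma gram_schmidt_norm_le1 d n : `|gram_schmidt d n| <= 1.
Proof.
have [->|e0] := eqVneq (gram_schmidt d n) 0; first by rewrite normr0.
by rewrite -(@ler_pXn2r _ 2) ?nnegrE // -dotp_norm dot_gram_schmidt // expr1n.
Qed.

Lemma dot_residual_gram_schmidt d n i x : (i < n)%N ->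
  dotp (residual d n x) (gram_schmidt d i) = 0.
Proof.
elim: n i x => // n IHn i x; rewrite ltnS leq_eqVlt => /predU1P[->|ltin].
  rewrite residualS linearBl /= dotZl.
  have [->|e0] := eqVneq (gram_schmidt d n) 0; first by rewrite !dot0r mulr0 subrr.
  by rewrite dot_gram_schmidt // mulr1 subrr.
rewrite residualS linearBl /= dotZl IHn //.
have -> : dotp (gram_schmidt d n) (gram_schmidt d i) = 0.
  by rewrite {1}/gram_schmidt normalizeE dotZl IHn // mulr0.
by rewrite mulr0 subrr.
Qed.

Lemma gram_schmidt_ortho d i j : i != j ->
  dotp (gram_schmidt d i) (gram_schmidt d j) = 0.
Proof.
wlog ltji : i j / (j < i)%N => [wl|_].
  by rewrite neq_ltn => /orP[] ltij; [rewrite dotC|];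
    apply: wl => //; rewrite neq_ltn ltij ?orbT.
by rewrite /gram_schmidt normalizeE dotZl dot_residual_gram_schmidt // mulr0.
Qed.

Lemma residualE d n x : residual d n x =
  x - \sum_(i < n) dotp x (gram_schmidt d i) *: gram_schmidt d i.
Proof.
elim: n x => [|n IHn] x; first by rewrite big_ord0 subr0.
rewrite residualS big_ord_recr /= opprD addrA -IHn; congr (_ - _ *: _).
rewrite IHn linearBl /= dot_suml big1 ?subr0 // => i _.
by rewrite /= dotZl gram_schmidt_ortho ?mulr0 // ltn_eqF.
Qed.

Lemma residual_sub d n x y : residual d n (x - y) = residual d n x - residual d n y.
Proof.
rewrite !residualE (opprD y) [RHS]addrACA -opprD; congr (_ - _).
rewrite -sumrB; apply: eq_bigr => i _.
by rewrite linearBl /= scalerBl.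
Qed.

Lemma residual_dot d n x y : dotp (residual d n x) y = dotp x (residual d n y).
Proof.
rewrite !residualE linearBl linearBr /=; congr (_ - _).
rewrite dot_suml linear_sumr /=; apply: eq_bigr => i _.
by rewrite dotZl [RHS]dotC dotZl mulrC (dotC y) (dotC x).
Qed.

Lemma residual_norm_sqr d n x : `|residual d n x| ^+ 2 =
  `|x| ^+ 2 - \sum_(i < n) dotp x (gram_schmidt d i) ^+ 2.
Proof.
have -> : `|residual d n x| ^+ 2 = dotp x (residual d n x).
  rewrite -dotp_norm {1}residualE linearBl /= dot_suml big1 ?subr0 // => i _.
  by rewrite dotZl (dotC _ (residual _ _ _)) dot_residual_gram_schmidt ?mulr0.
rewrite residualE linearBr /= dotp_norm; congr (_ - _).
by rewrite dotC dot_suml; apply: eq_bigr => i _; rewrite dotZl dotC -expr2 dotC.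
Qed.

Lemma residual_le d n x : `|residual d n x| <= `|x|.
Proof.
rewrite -(@ler_pXn2r _ 2) ?nnegrE // residual_norm_sqr gerBl.
by apply: sumr_ge0 => i _; rewrite sqr_ge0.
Qed.

(** At step i the residual of d i is a multiple of the new vector, so removing its
component along that vector leaves nothing. *)
Lemma residual_eq0 d n i : (i < n)%N -> residual d n (d i) = 0.
Proof.
elim: n i => // n IHn i; rewrite ltnS leq_eqVlt => /predU1P[->|ltin].
  rewrite residualS /gram_schmidt normalizeE.
  set r := residual d n (d n).
  have [->|r0] := eqVneq r 0; first by rewrite dot0l scale0r subrr.
  rewrite dotC dotZl dotp_norm scalerA expr2 mulKf ?normr_eq0 //.
  by rewrite divff ?normr_eq0 // scale1r subrr.
by rewrite residualS IHn // dot0l scale0r subrr.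
Qed.

(** If d i is within e of x, then for n > i the residual of x is that of x - d i,
and residuals do not increase the norm. *)
Lemma residual_cvg0 d x : dense (range d) -> `|residual d n x| @[n --> \oo] --> 0.
Proof.
move=> dd; apply/cvgrPdist_lt => e e0.
have [] := dd (ball x e); [by exists x; exact: ballxx| exact: ball_open|].
move=> y [/[swap] -[i _ <-] xe]; near=> n.
rewrite sub0r normrN normr_id; move: xe; rewrite -ball_normE /=; apply: le_lt_trans.
rewrite -[residual d n x]subr0 -(@residual_eq0 d n i); last by near: n; exists i.+1.
by rewrite -residual_sub residual_le.
Unshelve. all: by end_near. Qed.

(** The span is dense since it contains every d n: the residual of d n at step
n + 1 is zero, which expresses d n through the first n + 1 vectors. *)
Lemma gram_schmidt_basis d : dense (range d) ->
  orthonormal_basis [set e | exists2 n, e = gram_schmidt d n & gram_schmidt d n != 0].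
Proof.
move=> dd; split.
- by move=> _ [n -> e0]; rewrite dot_gram_schmidt.
- move=> _ _ [n -> _] [m -> _]; have [->|nm] := eqVneq n m; first by rewrite eqxx.
  by rewrite gram_schmidt_ortho.
- move=> O O0 oO; have [y [Ox [n _ dx]]] := dd O O0 oO; rewrite -dx in Ox.
  exists (d n); split=> //; clear dx Ox.
  pose e i := gram_schmidt d i.
  exists [seq e i | i <- [seq i <- iota 0 n.+1 | e i != 0]], (dotp (d n)); split.
    by move=> _ /mapP[i + ->]; rewrite mem_filter => /andP[e0 _]; exists i.
  have /eqP := residual_eq0 d n.+1 n (ltnSn n); rewrite residualE subr_eq0 => /eqP {1}->.
  rewrite big_map big_filter -(big_mkord xpredT (fun i => dotp (d n) (e i) *: e i)).
  rewrite /index_iota subn0 [RHS]big_mkcond; apply: eq_bigr => i _.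
  by case: eqVneq => // ->; rewrite scaler0.
Qed.

Lemma separable_dense_seq : separable H -> exists d : nat -> H, dense (range d).
Proof.
move=> [D cD dD].
have [D0|[f]] := pfcard_geP cD.
  by have [x [_]] := dD setT (ex_intro _ 0 I) openT; rewrite D0.
have /surjfunPex[d Dd] : $|{surjfun [set: nat] >-> D}| by exists; exact: f.
by exists d; rewrite -Dd.
Qed.

End hilbert_geometry.

(** * Finite rank operators *)

Section finite_rank.
Context {R : realType} {H K : hilbertType R}.
Variables (d : nat -> H) (n : nat) (h : nat -> K).

Definition finite_rank v : K := \sum_(i < n) dotp v (gram_schmidt d i) *: h i.

Fact finite_rank_linear : linear finite_rank.
Proof.
move=> a u v; rewrite /finite_rank scaler_sumr -big_split /=; apply: eq_bigr => i _.
by rewrite linearDl /= dotZl scalerDl scalerA.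
Qed.

HB.instance Definition _ := GRing.isLinear.Build R H K _ finite_rank finite_rank_linear.

Lemma finite_rank_continuous : continuous finite_rank.
Proof.
apply: bounded_linear_continuous; apply/linear_boundedP.
exists (\sum_(i < n) `|gram_schmidt d i| * `|h i|); split; first exact: num_real.
move=> r Mr v; apply: le_trans (ler_norm_sum _ _ _) _.
apply: (@le_trans _ _ ((\sum_(i < n) `|gram_schmidt d i| * `|h i|) * `|v|)); last first.
  by rewrite ler_wpM2r // ltW.
rewrite mulr_suml ler_sum // => i _; rewrite normrZ mulrAC ler_wpM2r //.
by rewrite mulrC cauchy_schwarz.
Qed.

(** On the Gram-Schmidt basis the operator vanishes off the first n vectors, which
reduces the sum over the basis to a finite one. *)
Lemma finite_rank_hilbert_schmidt : dense (range d) -> hilbert_schmidt finite_rank.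
Proof.
move=> /gram_schmidt_basis dd; split; first exact: finite_rank_continuous.
eexists; first exact: dd.
set B := [set _ | _].
pose F := [set gram_schmidt d i | i in `I_n].
rewrite (_ : esum _ _ = \esum_(e in B `&` F) (`|finite_rank e| ^+ 2)%:E)%E; last first.
  rewrite esum_mkcondr; apply: eq_esum => _ [m -> e0].
  case: ifPn => // /negP eF; rewrite /= /finite_rank big1 ?normr0 ?expr0n // => i _.
  rewrite gram_schmidt_ortho ?scale0r //; apply: contra_notN eF => /eqP ->.
  by rewrite inE; exists (val i) => /=.
have finBF : finite_set (B `&` F) by apply: finite_setIr; exact: finite_image.
by rewrite esum_fset // fsumEFin // ltry.
Qed.

End finite_rank.

(** * Square integrable functions and conditional expectation *)

Section L2_norm.
Context {d} {T : measurableType d} {R : realType}.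
Implicit Types (mu : {measure set T -> \bar R}) (f g : T -> R).
Local Open Scope ereal_scope.

Lemma measurable_sqr_abse f : measurable_fun [set: T] f ->
  measurable_fun [set: T] (fun x => `|(f x)%:E| `^ 2).
Proof.
move=> mf; apply: (measurableT_comp (measurable_poweR _)) => //.
by apply/measurableT_comp => //; exact/measurable_EFinP.
Qed.

Lemma le_Lnorm2 mu f g : measurable_fun [set: T] f -> measurable_fun [set: T] g ->
  (forall x, `|f x| <= `|g x|)%R ->
  'N[mu]_2%:E[EFin \o f] <= 'N[mu]_2%:E[EFin \o g].
Proof.
move=> mf mg fg; rewrite unlock; apply: gt0_ler_poweR.
- by rewrite invr_ge0.
- by rewrite in_itv/= leey integral_ge0 // => x _; exact: poweR_ge0.
- by rewrite in_itv/= leey integral_ge0 // => x _; exact: poweR_ge0.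
apply: ge0_le_integral => //.
- by move=> x _; exact: poweR_ge0.
- exact: measurable_sqr_abse.
- exact: measurable_sqr_abse.
- move=> x _; apply: gt0_ler_poweR => //.
  + by rewrite in_itv/= leey lee_fin normr_ge0.
  + by rewrite in_itv/= leey lee_fin normr_ge0.
  + by rewrite lee_fin.
Qed.

Lemma Lnorm2_sum_le mu n (c : nat -> R) (f : nat -> T -> R) (e : R) :
  (forall i, measurable_fun [set: T] (f i)) ->
  (forall i, (`|c i| <= 1)%R) ->
  (forall i, 'N[mu]_2%:E[EFin \o f i] <= e%:E) ->
  'N[mu]_2%:E[EFin \o (fun x => \sum_(i < n) c i * f i x)%R] <= (e *+ n)%:E.
Proof.
move=> mf c1 fe; elim: n => [|n IHn].
  under eq_Lnorm do rewrite /= big_ord0.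
  by rewrite Lnorm0 // eqe pnatr_eq0.
under eq_Lnorm do rewrite /= big_ord_recr.
have mcf i : measurable_fun [set: T] (fun x => c i * f i x)%R.
  exact: measurable_funM.
have ms : measurable_fun [set: T] (fun x => \sum_(i < n) c i * f i x)%R.
  by apply: measurable_sum => i; exact: mcf.
apply: le_trans (minkowski_EFin _ ms (mcf n) _) _; first by rewrite ler1n.
rewrite (mulrSr e) (EFinD (e *+ n)) leeD //; apply: le_trans (fe n).
by apply: le_Lnorm2 => // x; rewrite normrM ler_piMl.
Qed.

End L2_norm.

Section condexp_contraction.
Context {d d1 d2} {W : measurableType d} {T1 : measurableType d1}
  {T2 : measurableType d2} {R : realType}.
Context {Pr : probability W R} {X : {RV Pr >-> T1}} {Y : {RV Pr >-> T2}}.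
Context {p : R.-pker T1 ~> T2} (pXY : regular_cond_distribution X Y p).
Local Open Scope ereal_scope.

(** The Cauchy-Schwarz inequality against the constant 1 for the probability p x.
When f is not integrable for p x the left-hand side is at most the infinite
L^1 norm. *)
Lemma condexp_le_Lnorm2 (f : T2 -> R) x : measurable_fun [set: T2] f ->
  `|(condexp p f x)%:E| <= 'N[p x]_2%:E[EFin \o f].
Proof.
move=> mf; apply: (@le_trans _ _ 'N[p x]_1[EFin \o f]).
  rewrite Lnorm1; apply: le_trans (le_abse_integral (p x) measurableT _) => /=.
    rewrite /condexp /Rintegral/=.
    by case: (\int[p x]_y (f y)%:E) => [r||] /=; rewrite ?normr0 ?leey.
  exact/measurable_EFinP.
have := @hoelder _ _ _ (p x) f (cst 1%R) 2 2 mf (measurable_cst _).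
rewrite Lnorm_cst1 prob_kernel poweR1r mule1.
rewrite (_ : (f \* cst 1)%R = f); last by apply/funext => y /=; rewrite mulr1.
by apply => //; rewrite [RHS]splitr !div1r.
Qed.

(** Squaring the previous bound and integrating over the law of X turns its
right-hand side into the integral of |f|^2 under the law of Y, by
disintegration. *)
Lemma condexp_contraction (f : T2 -> R) : measurable_fun [set: T2] f ->
  'N[distribution Pr X]_2%:E[EFin \o condexp p f] <=
  'N[distribution Pr Y]_2%:E[EFin \o f].
Proof.
move=> mf; have mcf := measurable_condexp p mf.
rewrite unlock; apply: gt0_ler_poweR.
- by rewrite invr_ge0.
- by rewrite in_itv/= leey integral_ge0 // => x _; exact: poweR_ge0.
- by rewrite in_itv/= leey integral_ge0 // => x _; exact: poweR_ge0.
rewrite [leRHS](regular_cond_distribution_integral pXY); last 2 first.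
- by move=> y; exact: poweR_ge0.
- exact: measurable_sqr_abse.
apply: ge0_le_integral => //.
- by move=> x _; exact: poweR_ge0.
- exact: measurable_sqr_abse.
- apply: measurable_fun_integral_kernel => [U mU|y|].
  + exact: measurable_kernel.
  + exact: poweR_ge0.
  + exact: measurable_sqr_abse.
- move=> x _.
  have -> : \int[p x]_y `|(f y)%:E| `^ 2 = 'N[p x]_2%:E[EFin \o f] `^ 2.
    by rewrite poweR_Lnorm ?pnatr_eq0.
  apply: gt0_ler_poweR (condexp_le_Lnorm2 f x mf) => //.
  + by rewrite in_itv/= leey lee_fin normr_ge0.
  + by rewrite in_itv/= leey Lnorm_ge0.
Qed.

End condexp_contraction.

(** * Feature maps and spaces of continuous functions *)

Lemma continuous_borel_measurable {R : realType} {T : ptopologicalType} (f : T -> R) :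
  continuous f -> measurable_fun [set: borel T] (f : borel T -> R).
Proof.
move=> /continuousP cf; apply: (measurability _ (RGenOpens.measurableE R)).
move=> _ [_ [a [b ->] <-]]; rewrite setTI.
by apply: sub_sigma_algebra; exact/cf/interval_open.
Qed.

Lemma C0_bounded {R : realType} {E : topologicalType} {f : E -> R} :
  C0 f -> exists M, forall x, `|f x| <= M.
Proof.
move=> [cf /(_ 1 ltr01)[C cC fC]].
have /compact_bounded[M [_ fM]] : compact (f @` C).
  by apply: continuous_compact => //; exact: continuous_subspaceT.
exists (Num.max 1 (M + 1)) => x; rewrite le_max.
have [Cx|Cx] := pselect (C x); last by rewrite ltW // fC.
by rewrite orbC fM ?ltrDl //; exists x.
Qed.

Lemma residual_norm_continuous {R : realType} {H : hilbertType R} (d : nat -> H) n :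
  continuous (fun x => `|residual d n x|).
Proof.
move=> x; apply/cvgrPdist_lt => e e0; near=> y.
apply: le_lt_trans (ler_dist_dist _ _) _.
rewrite -residual_sub; apply: le_lt_trans (residual_le _ _ _) _.
by near: y; apply: cvgr_dist_lt.
Unshelve. all: by end_near. Qed.

(** Dominated convergence for the squares, the dominating function being the one of
index 0, where the residual is the identity. *)
Lemma residual_Lnorm2_le {R : realType} {H : hilbertType R} {d}
    {T : measurableType d} {mu : {measure set T -> \bar R}} {s : nat -> H}
    {phi : T -> H} {e : R} :
  dense (range s) ->
  (forall n, measurable_fun [set: T] (fun y => `|residual s n (phi y)|)) ->
  (\int[mu]_y (`|phi y| ^+ 2)%:E < +oo)%E -> 0 < e ->
  exists n, ('N[mu]_2%:E[EFin \o (fun y => `|residual s n (phi y)|)%R] <= e%:E)%E.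
Proof.
move=> ds ms phi2 e0.
pose f n y := (`|residual s n (phi y)| ^+ 2)%R%:E.
have mf n : measurable_fun [set: T] (f n).
  by apply/measurable_EFinP; exact: measurable_funX.
have ig : mu.-integrable [set: T] (f 0%N).
  apply/integrableP; split; first exact: mf.
  by under eq_integral do rewrite gee0_abs ?lee_fin ?exprn_ge0 //.
have f0 : {ae mu, forall y, [set: T] y -> f ^~ y @ \oo --> 0%E}.
  apply/aeW => y _; apply: cvg_EFin; first by near=> n.
  rewrite /f /comp /= -[X in _ --> X](mulr0 (0 : R)).
  under eq_fun do rewrite expr2.
  by apply: cvgM; exact: residual_cvg0.
have f_le : {ae mu, forall y n, [set: T] y -> (`|f n y| <= f 0%N y)%E}.
  apply/aeW => y n _; rewrite /f gee0_abs ?lee_fin ?exprn_ge0 // ler_pXn2r ?nnegrE //.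
  exact: residual_le.
have [_ _] := dominated_convergence measurableT mf (measurable_cst 0%E) f0 ig f_le.
rewrite integral0 => fcvg.
have /fcvg [n _ /(_ n (leqnn n)) fn] : nbhs (0%E : \bar R) [set x | (x < (e ^+ 2)%:E)%E].
  by apply: open_ereal_lt'; rewrite lte_fin exprn_gt0.
exists n; rewrite unlock.
rewrite -[e in leRHS]ger0_norm ?(ltW e0) // -sqrtr_sqr -[(Num.sqrt _)%:E]/(sqrte (e ^+ 2)%:E).
rewrite -poweR12_sqrt ?lee_fin ?exprn_ge0 ?(ltW e0) //.
have sqrE : (\int[mu]_y `|(`|residual s n (phi y)|)%R%:E| `^ 2 = \int[mu]_y f n y)%E.
  by apply: eq_integral => y _; rewrite /f /= normr_id powR_mulrn.
rewrite /comp sqrE; apply: gt0_ler_poweR.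
- by rewrite invr_ge0.
- by rewrite in_itv/= leey integral_ge0 // => y _; rewrite lee_fin exprn_ge0.
- by rewrite in_itv/= leey lee_fin exprn_ge0 ?(ltW e0).
exact: ltW fn.
Unshelve. all: by end_near. Qed.

Section condexp_rkhs.
Context {R : realType} {E : ptopologicalType} {k : E -> E -> R} (H : rkhs k).
Context (H_C0 : forall f : H, C0 (rkhs_fun H f)).

Lemma measurable_rkhs_fun (f : H) :
  measurable_fun [set: borel E] (rkhs_fun H f : borel E -> R).
Proof. exact: continuous_borel_measurable (H_C0 f).1. Qed.

Lemma integrable_rkhs_fun (mu : {measure set (borel E) -> \bar R}) (f : H) :
  (mu [set: borel E] < +oo)%E ->
  mu.-integrable [set: borel E] (EFin \o (rkhs_fun H f : borel E -> R)).
Proof.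
move=> mu_fin; apply: measurable_bounded_integrable => //.
- exact: measurable_rkhs_fun.
- have [M fM] := C0_bounded (H_C0 f).
  by exists M; split; [exact: num_real|move=> N MN x _; apply: le_trans (fM x) (ltW MN)].
Qed.

(** This holds at every point x because elements of H are bounded, hence integrable
for each p x; for general square integrable functions it would hold only almost
everywhere. *)
Lemma condexp_rkhs_linear (p : R.-pker borel E ~> borel E) a (u v : H) x :
  condexp p (rkhs_fun H (a *: u + v)) x =
  a * condexp p (rkhs_fun H u) x + condexp p (rkhs_fun H v) x.
Proof.
have int w : (p x).-integrable [set: borel E] (EFin \o (rkhs_fun H w : borel E -> R)).
  by apply: integrable_rkhs_fun; rewrite prob_kernel ltry.
rewrite /condexp linearD RintegralD //.
by rewrite linearZ RintegralZl //; exact: int.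
Qed.

Lemma condexp_rkhs_sum (p : R.-pker borel E ~> borel E) n (c : nat -> R) (u : nat -> H) v x :
  condexp p (rkhs_fun H (\sum_(i < n) c i *: u i + v)) x =
  \sum_(i < n) c i * condexp p (rkhs_fun H (u i)) x + condexp p (rkhs_fun H v) x.
Proof.
elim: n v => [|n IHn] v; first by rewrite !big_ord0 !add0r.
by rewrite !big_ord_recr /= -!addrA IHn condexp_rkhs_linear.
Qed.

End condexp_rkhs.

(** * Approximation of the conditional expectation operator *)

Theorem theorem3p3 (R : realType) (E : ptopologicalType)
    (E_second_countable : @second_countable E)
    (E_locally_compact : locally_compact [set: E])
    (E_hausdorff : hausdorff_space E)
    (d : measure_display) (W : measurableType d) (Pr : probability W R)
    (X Y : {RV Pr >-> borel E})
    (pi nu : probability (borel E) R)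
    (X_law : pi = distribution Pr X) (Y_law : nu = distribution Pr Y)
    (p : R.-pker borel E ~> borel E)
    (p_cond : regular_cond_distribution X Y p)
    (k : E -> E -> R) (H : rkhs k)
    (H_separable : separable H)
    (feature_measurable :
      measurable_fun [set: borel E] (rkhs_feature H : borel E -> borel H))
    (X_moment : ('E_Pr[fun w => (`|rkhs_feature H (X w)| ^+ 2)%R] < +oo)%E)
    (Y_moment : ('E_Pr[fun w => (`|rkhs_feature H (Y w)| ^+ 2)%R] < +oo)%E)
    (H_C0 : forall f : H, C0 (rkhs_fun H f))
    (H_dense : dense_in_L2 pi (range (rkhs_fun H)))
    (delta : R) (delta_gt0 : 0 < delta) :
  exists2 A : {linear H -> H}, hilbert_schmidt A &
    (L2_opnorm pi (fun f : H => rkhs_fun H (A f) \- condexp p (rkhs_fun H f))%R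
       < delta%:E)%E.
Proof.
subst pi nu.
pose pi := distribution Pr X; pose nu := distribution Pr Y.
have [s sdense] := separable_dense_seq H_separable.
pose phi : borel E -> H := rkhs_feature H.
pose e i := gram_schmidt s i.
have mr n : measurable_fun [set: borel E] (fun y => `|residual s n (phi y)|).
  apply: (measurableT_comp (f := (fun x => `|residual s n x|) : borel H -> R)) feature_measurable.
  exact: continuous_borel_measurable (residual_norm_continuous s n).
have nu_phi : (\int[nu]_y (`|phi y| ^+ 2)%:E < +oo)%E.
  rewrite ge0_integral_distribution //.
  - by move: Y_moment; rewrite unlock.
  - by apply/measurable_EFinP/measurable_funX; exact: (mr 0%N).
have delta4 : 0 < delta / 4 by rewrite divr_gt0.
have [n rn] := residual_Lnorm2_le sdense mr nu_phi delta4.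
(* With precision eps for each h i, the n approximation errors add up to at most
   delta / 4. *)
pose eps := delta / 4 / n.+1%:R.
have eps0 : 0 < eps by rewrite divr_gt0.
have mP f : measurable_fun [set: borel E] (condexp p (rkhs_fun H f)).
  exact: measurable_condexp (measurable_rkhs_fun H H_C0 f).
(* The reproducing property and self-adjointness of the residual move the residual
   from v to the feature vector. *)
have tail v : ('N[pi]_2%:E[EFin \o condexp p (rkhs_fun H (residual s n v))] <=
    'N[nu]_2%:E[EFin \o (fun y => `|v| * `|residual s n (phi y)|)%R])%E.
  apply: le_trans (condexp_contraction p_cond _ (measurable_rkhs_fun H H_C0 _)) _.
  apply: le_Lnorm2; first exact: measurable_rkhs_fun.
    exact: measurable_funM.
  move=> y; rewrite rkhs_reproducing residual_dot.
  by rewrite [leRHS]ger0_norm ?mulr_ge0 // cauchy_schwarz.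
have near_condexp i : exists h : H,
    ('N[pi]_2%:E[EFin \o (rkhs_fun H h \- condexp p (rkhs_fun H (e i)))%R] < eps%:E)%E.
  have [|_ [h _ <-] hlt] := H_dense (condexp p (rkhs_fun H (e i))) _ eps eps0; last by exists h.
  apply: (condexp_Lfun p_cond).
  have mf := measurable_rkhs_fun H H_C0 (e i).
  have [M eM] := C0_bounded (H_C0 (e i)).
  rewrite inE; apply/andP; split; rewrite inE //=; rewrite /finite_norm.
  apply: (@le_lt_trans _ _ 'N[nu]_2%:E[EFin \o cst M]%E).
    by apply: le_Lnorm2 => // x; apply: le_trans (eM x) (ler_norm _).
  rewrite unlock poweR_lty //.
  rewrite [integral _ _ _](integral_cst nu measurableT (`|M%:E| `^ 2)%E).
  rewrite [X in (_ * X)%E](probability_setT nu) mule1.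
  by rewrite poweR_EFin ltry.
have [h hP] := choice near_condexp.
exists (finite_rank s n h); first exact: finite_rank_hilbert_schmidt.
apply: (@le_lt_trans _ _ (delta / 2)%:E); last by rewrite lte_fin; lra.
apply: ge_ereal_sup => _ [v /= v1 <-].
pose c i := dotp v (e i).
pose f i := (rkhs_fun H (h i) \- condexp p (rkhs_fun H (e i))) : borel E -> R.
have mf i : measurable_fun [set: borel E] (f i).
  by apply: measurable_funB => //; exact: measurable_rkhs_fun.
have vE : v = \sum_(i < n) c i *: e i + residual s n v.
  by rewrite residualE addrC subrK.
have AvE : rkhs_fun H (finite_rank s n h v) \- condexp p (rkhs_fun H v) =
    (fun x => \sum_(i < n) c i * f i x) \+ (\- condexp p (rkhs_fun H (residual s n v))).
  apply/funext => x /=.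
  rewrite [in condexp _ _ _]vE (condexp_rkhs_sum H H_C0 p n c e) opprD addrA; congr (_ - _).
  rewrite /finite_rank linear_sum fct_sumE -sumrB; apply: eq_bigr => i _.
  by rewrite linearZ /f /= mulrBr.
rewrite AvE.
have c1 i : `|c i| <= 1.
  apply: le_trans (cauchy_schwarz _ _) _.
  by apply: mulr_ile1 => //; exact: gram_schmidt_norm_le1.
have msum : measurable_fun [set: borel E] (fun x => \sum_(i < n) c i * f i x).
  by apply: measurable_sum => i; exact: measurable_funM.
have mtail : measurable_fun [set: borel E] (\- condexp p (rkhs_fun H (residual s n v))).
  exact: measurableT_comp.
apply: le_trans (minkowski_EFin pi msum mtail _) _; first by rewrite ler1n.
have -> : delta / 2 = delta / 4 + delta / 4 by lra.
rewrite [leRHS]EFinD; apply: leeD.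
- apply: le_trans (Lnorm2_sum_le pi n c f eps mf c1 _) _; first by move=> i; exact/ltW/hP.
  rewrite lee_fin -(mulr_natr eps n) /eps -mulrA ler_piMr ?ltW //.
  by rewrite ltr_pdivrMl // mulr1 ltr_nat.
- apply: le_trans rn.
  apply: (@le_trans _ _ 'N[pi]_2%:E[EFin \o condexp p (rkhs_fun H (residual s n v))]%E).
    by apply: le_Lnorm2 => // x; rewrite normrN.
  apply: le_trans (tail v) _; apply: le_Lnorm2 => // [|y].
    exact: measurable_funM.
  by rewrite normrM !normr_id ler_piMl.
Qed.
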